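(* A sequence $(a_{n})_{n\ge1}$ of real numbers (minimal rational Cauchy filters) converges to a real number $b$ if, and only if, for all $B\in b$ there exists $n_{0}\in\mathbb{N}$ such that $B\in a_{n}$ for all $n\ge n_{0}$.
   Context: For $q\in\mathbb{Q}$ and rational $\varepsilon>0$ let $q_\varepsilon=\{x\in\mathbb{Q}\mid q-\varepsilon<x<q+\varepsilon\}$. A (rational) filter is a non-empty collection $\mathcal{F}$ of subsets of $\mathbb{Q}$ closed under binary intersections and under supersets (in $\mathbb{Q}$); the improper filter $\mathcal{P}(\mathbb{Q})$ is allowed as a filter. A filter $\mathcal{F}$ is Cauchy if for every rational $\varepsilon>0$ there is $q\in\mathbb{Q}$ with $q_\varepsilon\in\mathcal{F}$. A minimal Cauchy filter is a Cauchy filter $\mathcal{F}$ such that any Cauchy filter $\mathcal{G}\subseteq\mathcal{F}$ satisfies $\mathcal{G}=\mathcal{F}$. In this statement $\mathbb{R}$ denotes the set of all minimal Cauchy filters in $\mathbb{Q}$, and its elements are called real numbers. For $A,B\subseteq\mathbb{Q}$ write $A<_\forall B$ if $\alpha<\beta$ for all $\alpha\in A$ and $\beta\in B$. For real numbers $a,b$, $a<b$ means that there exist $A\in a$ and $B\in b$ with $A<_\forall B$. For $A,B\subseteq\mathbb{Q}$ let $A+B=\{\alpha+\beta\mid\alpha\in A,\beta\in B\}$; the sum $a+b$ of real numbers is the collection of all $C\subseteq\mathbb{Q}$ such that $C\supseteq A+B$ for some $A\in a$, $B\in b$. For $q\in\mathbb{Q}$, $\iota(q)=\{S\subseteq\mathbb{Q}\mid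 q_\varepsilon\subseteq S\text{ for some rational }\varepsilon>0\}$, a real number; $b-\iota(\varepsilon)$ denotes $b+\iota(-\varepsilon)$. A sequence $(a_n)_{n\ge1}$ of real numbers converges to $b$ (in the usual sense) if for every rational $\varepsilon>0$ there exists $n_0\in\mathbb{N}$ such that $b-\iota(\varepsilon)<a_n<b+\iota(\varepsilon)$ for all $n\ge n_0$. *)

(* Defs.v *)
From mathcomp Require Import all_boot all_order all_algebra.
From mathcomp Require Import lra.
From mathcomp Require Import boolp classical_sets filter.

Set Implicit Arguments.
Unset Strict Implicit.
Unset Printing Implicit Defensive.

Import Order.TTheory GRing.Theory Num.Theory.
Local Open Scope ring_scope.
Local Open Scope classical_set_scope.

Definition qball (q e : rat) : set rat := [set x | q - e < x < q + e].

(* [Filter] does not require [~ F set0], so the improper filter is allowed;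
   its field [filterT] is non-emptiness, given closure under supersets. *)
Definition cauchy_filter (F : set_system rat) : Prop :=
  Filter F /\ forall e : rat, 0 < e -> exists q : rat, F (qball q e).

Definition minimal_cauchy_filter (F : set_system rat) : Prop :=
  cauchy_filter F /\
  forall G : set_system rat, cauchy_filter G -> G `<=` F -> G = F.

Record creal : Type := CReal {
  creal_filter :> set rat -> Prop ;
  crealP : minimal_cauchy_filter creal_filter }.

Definition setlt (A B : set rat) : Prop :=
  forall x y : rat, A x -> B y -> x < y.

Definition creal_lt (a b : creal) : Prop :=
  exists A B : set rat, [/\ a A, b B & setlt A B].

Definition setadd (A B : set rat) : set rat := [set x + y | x in A & y in B].

Definition iota_filter (q : rat) : set_system rat :=
  [set S | exists2 e : rat, 0 < e & qball q e `<=` S].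

Definition add_filter (F G : set_system rat) : set_system rat :=
  [set C | exists A B : set rat, [/\ F A, G B & setadd A B `<=` C]].

Lemma iota_filter_cauchy (q : rat) : cauchy_filter (iota_filter q).
Proof.
split; last by move=> e e0; exists q; exists e.
split; first by exists 1.
- move=> P Q [e e0 eP] [f f0 fQ]; exists (Num.min e f).
    by rewrite lt_min e0.
  move=> x /andP[x1 x2]; have [ef fe] : Num.min e f <= e /\ Num.min e f <= f.
    by rewrite !ge_min !lexx orbT.
  by split; [apply: eP|apply: fQ]; apply/andP; split; lra.
- by move=> P Q PQ [e e0 eP]; exists e => // x /eP /PQ.
Qed.

Lemma iota_filterP (q : rat) : minimal_cauchy_filter (iota_filter q).
Proof.
split; first exact: iota_filter_cauchy.
move=> G [FG CG] GF; apply/seteqP; split=> // S [e e0 eS].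
have e2 : 0 < e / 2 by lra.
have [p Gp] := CG _ e2; have [d d0 dp] := GF _ Gp.
have /andP[p1 p2] : qball p (e / 2) q by apply: dp; apply/andP; split; lra.
apply: filterS Gp => x /andP[x1 x2].
by apply: eS; apply/andP; split; lra.
Qed.

Lemma minimal_cauchy_not_empty (F : set_system rat) :
  minimal_cauchy_filter F -> ~ F set0.
Proof.
move=> [[FF CF] mF] F0.
have sub : iota_filter 0 `<=` F by move=> S _; apply: filterS F0.
have := mF _ (iota_filter_cauchy 0) sub => E.
move: F0; rewrite -E => -[e e0 /(_ 0)]; apply.
by apply/andP; split; lra.
Qed.

Lemma minimal_cauchy_round (F : set_system rat) (A : set rat) :
  minimal_cauchy_filter F -> F A ->
  exists e B, [/\ 0 < e, F B & forall x, B x -> qball x e `<=` A].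
Proof.
move=> [[FF CF] mF].
pose G := [set S : set rat |
  exists e B, [/\ 0 < e, F B & forall x, B x -> qball x e `<=` S]].
suff E : G = F by rewrite -{1}E.
apply: mF; last first.
  move=> S [e [B [e0 FB BS]]]; apply: filterS FB => x /BS; apply.
  by apply/andP; split; lra.
split; first split.
- by exists 1, setT; split => //; exact: filterT.
- move=> P Q [e [B [e0 FB BP]]] [f [C [f0 FC CQ]]].
  exists (Num.min e f), (B `&` C); split; first by rewrite lt_min e0.
    exact: filterI.
  have [ef fe] : Num.min e f <= e /\ Num.min e f <= f.
    by rewrite !ge_min !lexx orbT.
  move=> x [Bx Cx] y /andP[y1 y2].
  by split; [apply: (BP x)|apply: (CQ x)] => //; apply/andP; split; lra.
- move=> P Q PQ [e [B [e0 FB BP]]]; exists e, B; split=> // x Bx y xy.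
  exact/PQ/(BP x).
- move=> e e0; have e2 : 0 < e / 2 by lra.
  have [q Fq] := CF _ e2; exists q; exists (e / 2), (qball q (e / 2)).
  split=> // x /andP[x1 x2] y /andP[y1 y2]; apply/andP; split; lra.
Qed.

Lemma add_filterP (F G : set_system rat) :
  minimal_cauchy_filter F -> minimal_cauchy_filter G ->
  minimal_cauchy_filter (add_filter F G).
Proof.
move=> mF mG; have [[FF CF] _] := mF; have [[FG CG] _] := mG.
split; first split; first split.
- by exists setT, setT; split; [exact: filterT|exact: filterT|].
- move=> P Q [A [B [FA GB AB]]] [A' [B' [FA' GB' AB']]].
  exists (A `&` A'), (B `&` B'); split; [exact: filterI|exact: filterI|].
  move=> _ [x [Ax A'x] [y [By B'y] <-]].
  by split; [apply: AB|apply: AB']; exists x => //; exists y.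
- move=> P Q PQ [A [B [FA GB AB]]]; exists A, B; split=> //.
  exact: subset_trans PQ.
- move=> e e0; have e2 : 0 < e / 2 by lra.
  have [p Fp] := CF _ e2; have [q Gq] := CG _ e2.
  exists (p + q), (qball p (e / 2)), (qball q (e / 2)); split=> //.
  by move=> _ [x /andP[x1 x2] [y /andP[y1 y2] <-]]; apply/andP; split; lra.
move=> H [FH CH] HFG; apply/seteqP; split=> // C [A [B [FA GB AB]]].
have [e [A1 [e0 FA1 A1A]]] := minimal_cauchy_round mF FA.
have e2 : 0 < e / 2 by lra.
have [p Hp] := CH _ e2; have [A2 [B2 [FA2 GB2 ABp]]] := HFG _ Hp.
have /set0P[a [A1a A2a]] : A1 `&` A2 != set0.
  apply/eqP => E; apply: (minimal_cauchy_not_empty mF).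
  by rewrite -E; exact: filterI.
have /set0P[b [Bb B2b]] : B `&` B2 != set0.
  apply/eqP => E; apply: (minimal_cauchy_not_empty mG).
  by rewrite -E; exact: filterI.
have /andP[ab1 ab2] : qball p (e / 2) (a + b).
  by apply: ABp; exists a => //; exists b.
apply: filterS Hp => x /andP[x1 x2]; apply: AB.
exists (x - b); last by exists b => //; rewrite subrK.
by apply: (A1A a) => //; apply/andP; split; lra.
Qed.

Definition creal_iota (q : rat) : creal := CReal (iota_filterP q).

Definition creal_add (a b : creal) : creal :=
  CReal (add_filterP (crealP a) (crealP b)).

(* Sequences are indexed by the positive integers: the value [a 0] of
   [a : nat -> creal] is irrelevant here. *)
Definition creal_cvg (a : nat -> creal) (b : creal) : Prop :=
  forall e : rat, 0 < e ->
  exists n0 : nat, forall n : nat, (1 <= n)%N -> (n0 <= n)%N ->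
    creal_lt (creal_add b (creal_iota (- e))) (a n) /\
    creal_lt (a n) (creal_add b (creal_iota e)).

(* Main.v *)
(** A real number is determined by its arbitrarily small intervals.  For the
    direct implication, roundness of [b] gives [B1] in [b] and [e > 0] such that
    [B] contains the [e]-neighbourhood of [B1]; the two inequalities defining
    convergence at [e / 4] confine [a n] to an interval ]x - e/4, y + e/4[, with
    [x] and [y] in [B1] and |x - y| < e/2, so this interval lies in the
    [e]-neighbourhood of [x].  For the converse, an interval of radius [e / 4]
    in [b] eventually belongs to [a n] and witnesses both inequalities. *)
Require Import Defs.
From mathcomp Require Import all_boot all_order all_algebra.
From mathcomp Require Import lra.
From mathcomp Require Import boolp classical_sets filter.

Set Implicit Arguments.
Unset Strict Implicit.
Unset Printing Implicit Defensive.

Import Order.TTheory GRing.Theory Num.Theory.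
Local Open Scope ring_scope.
Local Open Scope classical_set_scope.

Lemma creal_is_filter (a : creal) : Filter a.
Proof. by have [[]] := crealP a. Qed.
#[local] Existing Instance creal_is_filter.

Lemma creal_setI_nonempty (a : creal) (A B : set rat) :
  a A -> a B -> A `&` B !=set0.
Proof.
move=> aA aB; apply/set0P/eqP => AB0.
by apply: (minimal_cauchy_not_empty (crealP a)); rewrite -AB0; exact: filterI.
Qed.

Lemma creal_qball (a : creal) (e : rat) : 0 < e -> exists q, a (qball q e).
Proof. by have [[_ Ca] _] := crealP a; exact: Ca. Qed.

Lemma qball_center (q e : rat) : 0 < e -> qball q e q.
Proof. by move=> e0; apply/andP; split; lra. Qed.

(** Since [q] lies in every member of [iota_filter q], the lower witness contains [x + q] for each
    [x] common to [B] and its summand from [b]; properness of [b] provides such an [x]. *)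
Lemma creal_lt_addl_gt (a b : creal) (q : rat) (B : set rat) :
  creal_lt (creal_add b (creal_iota q)) a -> b B ->
  exists2 x, B x & a [set z | x + q < z].
Proof.
move=> [A [C [[D [I [bD [e e0 qI] DIA]]] aC AC]]] bB.
have [x [Dx Bx]] := creal_setI_nonempty bD bB.
exists x => //; apply: filterS aC => z Cz; apply: AC Cz; apply: DIA.
by exists x => //; exists q => //; exact/qI/qball_center.
Qed.

Lemma creal_lt_addr_lt (a b : creal) (q : rat) (B : set rat) :
  creal_lt a (creal_add b (creal_iota q)) -> b B ->
  exists2 x, B x & a [set z | z < x + q].
Proof.
move=> [C [A [aC [D [I [bD [e e0 qI] DIA]]] CA]]] bB.
have [x [Dx Bx]] := creal_setI_nonempty bD bB.
exists x => //; apply: filterS aC => z Cz; apply: (CA _ _ Cz); apply: DIA.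
by exists x => //; exists q => //; exact/qI/qball_center.
Qed.

Lemma creal_add_iota_qball (b : creal) (B : set rat) (q e : rat) :
  0 < e -> b B -> creal_add b (creal_iota q) (setadd B (qball q e)).
Proof. by move=> e0 bB; exists B, (qball q e); split => //; exists e. Qed.

Theorem lemma5p2 (a : nat -> creal) (b : creal) :
  creal_cvg a b <->
  (forall B : set rat, b B ->
     exists n0 : nat, forall n : nat, (1 <= n)%N -> (n0 <= n)%N -> a n B).
Proof.
split=> [ab B bB|ab e e0].
  have [e [B1 [e0 bB1 B1B]]] := minimal_cauchy_round (crealP b) bB.
  have e4 : 0 < e / 4 by lra.
  have [q bq] := creal_qball b e4.
  have [n0 ab_n0] := ab _ e4; exists n0 => n n1 n0n.
  have [lb ub] := ab_n0 n n1 n0n.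
  (* The ball forces [x] and [y], both drawn from this set, to differ by less than [e / 2]. *)
  have bI : b (B1 `&` qball q (e / 4)) by exact: filterI.
  have [x [B1x /andP[x1 x2]] ax] := creal_lt_addl_gt lb bI.
  have [y [_ /andP[y1 y2]] ay] := creal_lt_addr_lt ub bI.
  apply: filterS (filterI ax ay) => z [/= xz zy].
  by apply: (B1B x B1x); apply/andP; split; lra.
have e4 : 0 < e / 4 by lra.
have [q bq] := creal_qball b e4.
have [n0 an_q] := ab _ bq; exists n0 => n n1 n0n.
have aq := an_q n n1 n0n.
split.
(* The sums stay below [q - e / 2], the ball above [q - e / 4]; the upper bound is symmetric. *)
- exists (setadd (qball q (e / 4)) (qball (- e) (e / 4))), (qball q (e / 4)).
  split=> //; first exact: creal_add_iota_qball.
  by move=> _ z [x /andP[x1 x2] [y /andP[y1 y2] <-]] /andP[z1 z2]; lra.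
- exists (qball q (e / 4)), (setadd (qball q (e / 4)) (qball e (e / 4))).
  split=> //; first exact: creal_add_iota_qball.
  by move=> z _ /andP[z1 z2] [x /andP[x1 x2] [y /andP[y1 y2] <-]]; lra.
Qed.
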